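(* If $X$ and $Y$ are random sets in $\mathfrak{X}$, then $$\mathbf{M}(X+Y|\mathcal{H})\subset\operatorname{cl}\Big(\mathbf{M}(X|\mathcal{H})+\mathbf{M}(Y|\mathcal{H})\Big)\quad\text{a.s.}$$ If $Y$ is $\mathcal{H}$-measurable and convex, then $$\mathbf{M}(X+Y|\mathcal{H})=\operatorname{cl}(\mathbf{M}(X|\mathcal{H})+Y)\quad\text{a.s.}$$
   Context: $\mathfrak{X}$ is a separable real Banach space with Borel $\sigma$-algebra $\mathcal{B}(\mathfrak{X})$; $(\Omega,\mathcal{F},\mathbf{P})$ is a complete probability space and $\mathcal{H}\subset\mathcal{F}$ is a sub-$\sigma$-algebra. An $\mathcal{H}$-measurable random set is a set-valued function $\omega\mapsto X(\omega)\subset\mathfrak{X}$ (empty values allowed) whose graph belongs to $\mathcal{H}\otimes\mathcal{B}(\mathfrak{X})$; ''random set'' means $\mathcal{F}$-measurable; it is closed (convex) if its values are closed (convex) for almost all $\omega$. The conditional convex hull $\mathbf{M}(X|\mathcal{H})$ is the smallest (with respect to a.s. inclusion) $\mathcal{H}$-measurable random convex closed set which a.s. contains $X$; it exists for every random set. The sum is pointwise: $A+B=\{x+y:\ x\in A,\ y\in B\}$, and $\operatorname{cl}$ is the norm closure, both applied for each $\omega$. Relations between random sets are understood almost surely. *)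

(* Defs.v *)
From HB Require Import structures.
From mathcomp Require Import all_boot all_order all_algebra.
From mathcomp Require Import all_classical all_reals all_analysis.
Import Order.TTheory GRing.Theory Num.Theory.
Import numFieldNormedType.Exports.

Set Implicit Arguments.
Unset Strict Implicit.
Unset Printing Implicit Defensive.

Local Open Scope classical_set_scope.
Local Open Scope ring_scope.

Definition separable (T : topologicalType) : Prop :=
  exists2 D : set T, countable D & dense D.

Definition minkowski_sum (V : zmodType) (A B : set V) : set V :=
  [set x + y | x in A & y in B].

Section RandomSets.
Context {R : realType} {E : completeNormedModType R}.
Context {d : measure_display} {Omega : measurableType d}.

(* The product sigma-algebra is that of the product of the measurable types
   generated by G and by the open sets of E, hence G (x) B(E) as soon as G is
   a sigma-algebra. *)
Definition random_set (G : set (set Omega)) (X : Omega -> set E) : Prop :=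
  measurable ([set p | X p.1 p.2] :
    set (g_sigma_algebraType G * g_sigma_algebraType (@open E))%type).

Definition as_convex (P : probability Omega R) (X : Omega -> set E) : Prop :=
  {ae P, forall w, convex_set (X w)}.

Definition random_convex_closed_set (P : probability Omega R)
    (G : set (set Omega)) (X : Omega -> set E) : Prop :=
  [/\ random_set G X, as_convex P X & {ae P, forall w, closed (X w)}].

Definition as_subset (P : probability Omega R) (X Y : Omega -> set E) : Prop :=
  {ae P, forall w, X w `<=` Y w}.

Definition as_equal (P : probability Omega R) (X Y : Omega -> set E) : Prop :=
  {ae P, forall w, X w = Y w}.

(* M is a version of the conditional convex hull M(X|H), which is determined
   only up to a.s. equality. X need not have a measurable graph here: the
   pointwise sum of two random sets may fail to have one, its values being
   only analytic in general. *)
Definition is_cond_convex_hull (P : probability Omega R)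
    (H : set (set Omega)) (X M : Omega -> set E) : Prop :=
  [/\ random_convex_closed_set P H M,
      as_subset P X M &
      forall N : Omega -> set E, random_convex_closed_set P H N ->
        as_subset P X N -> as_subset P M N].

End RandomSets.

(* Main.v *)
Require Import Defs.
From HB Require Import structures.
From mathcomp Require Import all_boot all_order all_algebra.
From mathcomp Require Import all_classical all_reals all_analysis.
From mathcomp Require Import lra.
Import Order.TTheory GRing.Theory Num.Theory.
Import numFieldNormedType.Exports.

Local Open Scope classical_set_scope.
Local Open Scope ring_scope.

(** Both inclusions follow from the minimality of a conditional hull, applied
    to a well chosen competitor.

    For the first one, the closure of [MX + MY] is convex, closed and contains
    [X + Y]; once it is known to be [H]-measurable, it contains the hull of
    [X + Y]. The same argument with a convex [Y] in the place of [MY] gives one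
    half of the equality. For the other half, consider the Minkowski difference
    of [MXY] by [Y], i.e. the set of all [x] with [x + Y w] contained in
    [MXY w]. It is convex, closed and contains [X]; once it is known to be
    [H]-measurable, it contains [MX], which says that [MX + Y] is contained in
    [MXY], and so is its closure.

    All the difficulty is in the measurability of these two competitors, whose
    definitions quantify over points of [E], and it is settled by the
    measurable projection theorem ([measurable_projection]): the projection on
    [Omega] of a set in the product sigma-algebra belongs to [H], if [H]
    contains the null sets. Its proof represents measurable sets of the
    product by the Souslin operation ([souslin_product_measurable]) and then
    compares the sets of the resulting tree with their measurable envelopes
    ([measurable_envelope]). Consequently the event that a random set meets a
    given ball is in [H]; by separability of [E] this makes the closure of a
    sum ([effros_measurable_minkowski_sum], [random_set_closure]) and the
    Minkowski difference ([random_set_minkowski_difference]) random sets.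

    The sigma-algebra [H] itself need not contain the null sets. It is
    therefore first replaced by its completion, which is harmless because a
    random set over the completion is a.s. equal to a random set over [H]
    ([random_set_completion], [cond_convex_hull_completion]). *)

(** * Operations in a sigma-algebra of sets *)

Lemma bigcup_unpickle {T : Type} {I : countType} (F : I -> set T) :
  \bigcup_i F i =
  \bigcup_n (if unpickle n is Some i then F i else set0).
Proof.
apply/seteqP; split=> [x [i _ Fix]|x [n _]].
  by exists (pickle i) => //; rewrite pickleK.
by case: (unpickle n) => // i Fix; exists i.
Qed.

Section SigmaAlgebra.
Context {T : pointedType} {H : set (set T)} (sigmaH : sigma_algebra setT H).

Lemma sigma_algebra_bigcupT (F : nat -> set T) :
  (forall i, H (F i)) -> H (\bigcup_i F i).
Proof. by case: sigmaH => _ _; exact. Qed.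

Lemma sigma_algebra_setC (A : set T) : H A -> H (~` A).
Proof. by case: sigmaH => _ + _ HA => /(_ _ HA); rewrite setTD. Qed.

Lemma sigma_algebra_bigcapT (F : nat -> set T) :
  (forall i, H (F i)) -> H (\bigcap_i F i).
Proof.
move=> HF; rewrite -(setCK (\bigcap_i F i)) setC_bigcap.
apply/sigma_algebra_setC/sigma_algebra_bigcupT => i.
exact/sigma_algebra_setC.
Qed.

Lemma sigma_algebra_set0 : H set0.
Proof. by case: sigmaH. Qed.

Lemma sigma_algebra_setT : H setT.
Proof. by rewrite -setC0; apply/sigma_algebra_setC/sigma_algebra_set0. Qed.

Lemma sigma_algebra_setU (A B : set T) : H A -> H B -> H (A `|` B).
Proof.
move=> HA HB; rewrite -bigcup2E; apply: sigma_algebra_bigcupT => -[|[|i]] //.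
exact: sigma_algebra_set0.
Qed.

Lemma sigma_algebra_setI (A B : set T) : H A -> H B -> H (A `&` B).
Proof.
move=> HA HB; rewrite -(setCK (A `&` B)) setCI.
by apply/sigma_algebra_setC/sigma_algebra_setU; apply: sigma_algebra_setC.
Qed.

Lemma sigma_algebra_setD (A B : set T) : H A -> H B -> H (A `\` B).
Proof.
by move=> HA HB; rewrite setDE; apply/sigma_algebra_setI/sigma_algebra_setC.
Qed.

Lemma sigma_algebra_bigcup_count {I : countType} (F : I -> set T) :
  (forall i, H (F i)) -> H (\bigcup_i F i).
Proof.
move=> HF; rewrite bigcup_unpickle; apply: sigma_algebra_bigcupT => n.
by case: unpickle => // *; exact: sigma_algebra_set0.
Qed.

End SigmaAlgebra.

Lemma negligible_bigcup_count {R : realType} {d : measure_display}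
    {T : measurableType d} (mu : {measure set T -> \bar R}) {I : countType}
    (F : I -> set T) :
  (forall i, mu.-negligible (F i)) -> mu.-negligible (\bigcup_i F i).
Proof.
move=> F0; rewrite bigcup_unpickle; apply: negligible_bigcup => n.
by case: unpickle => // *; exact: negligible_set0.
Qed.

(** * Measurable envelopes *)

Section Envelope.
Context {R : realType} {d : measure_display} {Omega : measurableType d}.
Variables (P : probability Omega R) (H : set (set Omega)).
Hypotheses (sigmaH : sigma_algebra setT H) (subH : H `<=` measurable).

(** The intersection of a sequence of [H]-covers of [Z] whose probabilities
    approach the infimum is minimal up to null sets, since cutting it by a
    further cover cannot lower its probability. Intersecting it as well with
    those of countably many prescribed sets that happen to contain [Z] keeps
    minimality, and turns some of the a.s. inclusions into inclusions at every
    point. *)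
Lemma measurable_envelope (Z : set Omega) (C : nat -> set Omega) :
  (forall j, H (C j)) ->
  exists B, [/\ H B, Z `<=` B, forall j, Z `<=` C j -> B `<=` C j &
    forall D, H D -> Z `<=` D -> P.-negligible (B `\` D)].
Proof.
move=> HC.
pose V := [set P B | B in [set B | H B /\ Z `<=` B]].
have infV : ereal_inf V \is a fin_num.
  apply/fin_numP; split; apply/eqP => Vy.
    have : (0 <= ereal_inf V)%E by apply: le_ereal_inf_tmp => _ [B _ <-].
    by rewrite Vy.
  have : (ereal_inf V <= P setT)%E.
    apply: ereal_inf_lbound; exists setT => //; split => //.
    exact: sigma_algebra_setT.
  by rewrite Vy probability_setT.
have n0 n : 0 < n.+1%:R^-1 :> R by rewrite invr_gt0.
have /choice[B BP] (n : nat) : exists B, [/\ H B, Z `<=` B &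
    (P B < ereal_inf V + (n.+1%:R^-1)%:E)%E].
  have [_ [B [HB ZB] <-] ?] := lb_ereal_inf_adherent (n0 n) infV.
  by exists B.
pose C' j := if `[< Z `<=` C j >] then C j else setT.
have HC' j : H (C' j).
  rewrite /C'; case: ifP => _ //; exact: sigma_algebra_setT.
pose A := (\bigcap_n B n) `&` (\bigcap_j C' j).
have HA : H A.
  apply: sigma_algebra_setI => //; apply: sigma_algebra_bigcapT => // n.
  by case: (BP n).
have ZA : Z `<=` A.
  move=> w Zw; split => n _; first by case: (BP n) => _ + _; apply.
  by rewrite /C'; case: ifPn => // /asboolP; apply.
have PA : (P A <= ereal_inf V)%E.
  apply/lee_addgt0Pr => e e0.
  have [n ne] : exists n : nat, n.+1%:R^-1 < e.
    by have [n] := ltr_add_invr e0; rewrite add0r; exists n.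
  have [HB _ /ltW PB] := BP n.
  apply: (le_trans (y := P (B n))).
    by apply: le_measure; rewrite ?inE; [exact: subH..|move=> w [+ _]; apply].
  by apply: (le_trans PB); rewrite leeD2l// lee_fin ltW.
exists A; split => // [j ZC w [_ /(_ j I)]|D HD ZD].
  by rewrite /C'; case: ifPn => // /asboolP.
exists (A `\` D); split => //.
  by apply: subH; exact: sigma_algebra_setD.
have mA : measurable A by exact: subH.
have mD : measurable D by exact: subH.
rewrite measureD //; last first.
  by rewrite (le_lt_trans (probability_le1 P mA)) // ltry.
apply/eqP; rewrite eq_le; apply/andP; split; last first.
  rewrite sube_ge0 ?fin_num_measure//; last exact: measurableI.
  by apply: le_measure; rewrite ?inE //; exact: measurableI.
rewrite sube_le0; apply: (le_trans PA); apply: ereal_inf_lbound.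
exists (A `&` D) => //; split; first exact: sigma_algebra_setI.
by move=> w Zw; split; [exact: ZA|exact: ZD].
Qed.

End Envelope.

(** * The product sigma-algebra *)

Section ProductSigmaAlgebra.
Context {R : realType} {E : completeNormedModType R}.
Context {d : measure_display} {Omega : measurableType d}.
Variable H : set (set Omega).

Definition product_measurable (S : set (Omega * E)) : Prop :=
  measurable
    (S : set (g_sigma_algebraType H * g_sigma_algebraType (@open E))%type).

Lemma product_measurable_sigma : sigma_algebra setT product_measurable.
Proof. exact: sigma_algebra_measurable. Qed.

Lemma product_measurable_rect (A : set Omega) (O : set E) :
  H A -> open O -> product_measurable (A `*` O).
Proof. by move=> HA oO; apply: measurableX; apply: sub_sigma_algebra. Qed.

Lemma product_measurable_ind (C : set (set (Omega * E))) :
  sigma_algebra setT H -> sigma_algebra setT C ->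
  (forall A, H A -> C (A `*` setT)) -> (forall O, open O -> C (setT `*` O)) ->
  product_measurable `<=` C.
Proof.
move=> sigmaH sigmaC CA CO; apply: smallest_sub => // S [] [B mB <-];
  rewrite setTI.
- rewrite -[X in C X]setXT; apply: CA; move: mB.
  by rewrite /measurable/= sigma_algebra_id.
- rewrite -[X in C X]setTX.
  suff : (@measurable _ (g_sigma_algebraType (@open E)))
    `<=` [set B | C (setT `*` B)] by exact.
  apply: smallest_sub => //; split => [/=|A /= CA'|F /= CF].
  + by rewrite setX0; exact: sigma_algebra_set0.
  + have -> : setT `*` (setT `\` A) = ~` (setT `*` A) :> set (Omega * E).
      apply/seteqP; split => [x [_ [_ ?]] [_]|x nA] //.
      by split => //; split => // ?; exact: nA.
    exact: sigma_algebra_setC.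
  + by rewrite setX_bigcupr; exact: sigma_algebra_bigcupT.
Qed.

End ProductSigmaAlgebra.
Arguments product_measurable {R E d Omega}.

(** * Souslin sets *)

Section Souslin.
Context {R : realType} {E : completeNormedModType R}.
Context {d : measure_display} {Omega : measurableType d}.
Variables (H : set (set Omega)) (sigmaH : sigma_algebra setT H).

(** This is continuity on Baire space for the discrete topology of the
    codomain: the value at a branch depends on finitely many of its terms. *)
Definition locally_constant {T : Type} (g : (nat -> nat) -> T) : Prop :=
  forall f, exists s : seq nat,
    forall f', {in s, f' =1 f} -> g f' = g f.

(** These are the projections, along Baire space, of countable intersections of
    sets whose section at each branch is a rectangle with closed side in [E],
    that is, the results of the Souslin operation on such rectangles. Letting
    the rectangle depend on the whole branch in a locally constant way avoids
    any bookkeeping on finite sequences when branches are recoded. *)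
Definition souslin (S : set (Omega * E)) : Prop :=
  exists K : nat -> (nat -> nat) -> set Omega * set E,
  [/\ forall j f, H (K j f).1 /\ closed (K j f).2,
      forall j, locally_constant (K j) &
      S = [set p | exists f, forall j, ((K j f).1 `*` (K j f).2) p]].

Lemma souslin_rect (A : set Omega) (F : set E) :
  H A -> closed F -> souslin (A `*` F).
Proof.
move=> HA cF; exists (fun _ _ => (A, F)); split => //.
- by move=> j f; exists [::].
- by apply/seteqP; split => [p Ap|p [f /(_ 0%N)]] //; exists id.
Qed.

Lemma souslin_bigcup (S : nat -> set (Omega * E)) :
  (forall i, souslin (S i)) -> souslin (\bigcup_i S i).
Proof.
move=> /choice[K KP].
(* the first term of the branch selects the index of the union *)
exists (fun j f => K (f 0%N) j (f \o succn)); split.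
- by move=> j f; have [+ _ _] := KP (f 0%N); exact.
- move=> j f; have [_ + _] := KP (f 0%N) => /(_ j (f \o succn))[s sP].
  exists (0%N :: map succn s) => f' ff'.
  rewrite /= (ff' 0%N) ?mem_head//; apply: sP => i si /=.
  by apply: ff'; rewrite inE map_f ?orbT.
- apply/seteqP; split => [p [i _]|p [f fp]].
    have [_ _ ->] := KP i; move=> [f fp].
    by exists (fun n => if n is m.+1 then f m else i).
  exists (f 0%N) => //; have [_ _ ->] := KP (f 0%N).
  by exists (f \o succn).
Qed.

Lemma souslin_bigcap (S : nat -> set (Omega * E)) :
  (forall i, souslin (S i)) -> souslin (\bigcap_i S i).
Proof.
move=> /choice[K KP].
pose br (f : nat -> nat) (i n : nat) : nat := f (pickle (i, n)).
pose idx n : nat * nat := odflt (0, 0)%N (unpickle n).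
(* one branch encodes the branches of all the sets at once *)
exists (fun n f => K (idx n).1 (idx n).2 (br f (idx n).1)); split.
- by move=> n f; have [+ _ _] := KP (idx n).1; exact.
- move=> n f; have [_ + _] := KP (idx n).1.
  move=> /(_ (idx n).2 (br f (idx n).1))[s sP].
  exists [seq pickle ((idx n).1, i) | i <- s] => f' ff'.
  apply: sP => i si; apply: ff'; exact: map_f.
- apply/seteqP; split => [p Sp|p [f fp] i _].
    have /choice[f fp] i : exists f, forall j, ((K i j f).1 `*` (K i j f).2) p.
      by have [_ _ /seteqP[+ _]] := KP i; apply; exact: Sp.
    exists (fun m => f (idx m).1 (idx m).2) => n.
    suff -> : br (fun m => f (idx m).1 (idx m).2) (idx n).1 = f (idx n).1 by [].
    by apply/funext => k; rewrite /br /idx pickleK.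
  have [_ _ ->] := KP i; exists (br f i) => j.
  by have := fp (pickle (i, j)); rewrite /idx pickleK.
Qed.

(** The points whose distance to the complement of [O] is at least [1/(n+1)]
    form a closed set, and these sets exhaust [O]. *)
Lemma open_bigcup_closed (O : set E) : open O ->
  exists2 F : nat -> set E, (forall n, closed (F n)) & O = \bigcup_n F n.
Proof.
move=> oO; exists (fun n => [set x | ball x n.+1%:R^-1 `<=` O]).
  move=> n x clx y xy.
  have e0 : 0 < n.+1%:R^-1 - `|x - y|.
    by rewrite subr_gt0; move: xy; rewrite -ball_normE.
  have [z [Oz xz]] := clx _ (nbhsx_ballx x _ e0); apply: Oz.
  move: xz; rewrite -!ball_normE /= distrC => xz.
  by rewrite -(subrKA x) (le_lt_trans (ler_normD _ _))// -ltrBrDr.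
apply/seteqP; split => [x Ox|x [n _]]; last first.
  by apply; apply: ballxx; rewrite invr_gt0.
have /nbhs_ballP[e /= e0 eO] : nbhs x O by exact: open_nbhs_nbhs.
have [n] := ltr_add_invr e0; rewrite add0r => ne.
by exists n => // y xy; apply: eO; exact: le_ball (ltW ne) _ xy.
Qed.

Lemma souslin_open (O : set E) : open O -> souslin (setT `*` O).
Proof.
move=> /open_bigcup_closed[F cF ->].
rewrite setX_bigcupr; apply: souslin_bigcup => n; apply: souslin_rect => //.
exact: sigma_algebra_setT.
Qed.

(** Souslin sets are not stable under complement, but those whose complement is
    Souslin too form a sigma-algebra, and it contains the generating cylinders
    because an open set of [E] is a countable union of closed ones. *)
Lemma souslin_product_measurable :
  @product_measurable R E d Omega H `<=` souslin.
Proof.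
suff : @product_measurable R E d Omega H `<=`
    souslin `&` [set S | souslin (~` S)].
  by move=> SS S /SS [].
have HT := sigma_algebra_setT sigmaH.
apply: product_measurable_ind => //.
- have s0 : souslin set0.
    rewrite -(@setX0 Omega E setT); apply: souslin_rect => //.
    exact: closed0.
  split => [|A [/= sA sA']|F sF].
  + split => //=; rewrite setC0 -setXTT; apply: souslin_rect => //.
  + by rewrite setTD; split => //=; rewrite setCK.
  + split; first by apply: souslin_bigcup => i; have [] := sF i.
    by rewrite /= setC_bigcup; apply: souslin_bigcap => i; have [] := sF i.
- move=> A HA; split; first by apply: souslin_rect => //; exact: closedT.
  rewrite /=; have -> : ~` (A `*` setT) = ~` A `*` setT :> set (Omega * E).
    apply/seteqP; split => [x nAx|x [nAx _] [] //].
    by split => // Ax; apply: nAx.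
  apply: souslin_rect => //; first exact: sigma_algebra_setC.
- move=> O oO; split; first exact: souslin_open.
  rewrite /=; have -> : ~` (setT `*` O) = setT `*` ~` O :> set (Omega * E).
    apply/seteqP; split => [x nAx|x [_ nAx] [] //].
    by split => // Ax; apply: nAx.
  by apply: souslin_rect => //; exact: open_closedC.
Qed.

End Souslin.

(** * The measurable projection theorem *)

Lemma separable_dense_sequence {R : realType} {E : completeNormedModType R} :
  separable E ->
  exists q : nat -> E, forall x (e : R), 0 < e -> exists k, ball x e (q k).
Proof.
move=> [D cD dD].
have [q qD] : exists q : nat -> E, D `<=` range q.
  have /pfcard_geP[->|[f]] := cD; first by exists (fun=> 0).
  by exists f => y /(@surj _ _ _ _ f)[k _ <-]; exists k.
exists q => x e e0.
have [|y [xy Dy]] := dD (ball x e) _ (ball_open x e).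
  by exists x; exact: ballxx.
by have [k _ qk] := qD _ Dy; exists k; rewrite qk.
Qed.

Section Projection.
Context {R : realType} {E : completeNormedModType R} (sepE : separable E).
Context {d : measure_display} {Omega : measurableType d}.
Variables (P : probability Omega R) (H : set (set Omega)).
Hypotheses (sigmaH : sigma_algebra setT H) (subH : H `<=` measurable).
Hypothesis nullH : P.-negligible `<=` H.

(** This is dependent choice for finite sequences. *)
Lemma exists_branch {T : Type} (t0 : T) (B : seq T -> Prop) :
  B [::] -> (forall s, B s -> exists c, B (rcons s c)) ->
  exists h : nat -> T, forall n, B (mkseq h n).
Proof.
move=> B0 BS.
have /choice[c cP] s : exists c, B s -> B (rcons s c).
  have [/BS[c Bc]|nB] := pselect (B s); first by exists c.
  by exists t0 => /nB.
pose br n := iter n (fun s => rcons s (c s)) [::].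
have sbr n : size (br n) = n by elim: n => //= n IH; rewrite size_rcons IH.
exists (fun n => c (br n)) => n.
suff -> : mkseq (fun n => c (br n)) n = br n by elim: n => //= n /cP.
by elim: n => // n IH; rewrite mkseqS IH.
Qed.

Lemma rcons_agree {T : Type} (t0 : T) (h : nat -> T) s c :
  (forall k, (k < size (rcons s c))%N -> h k = nth t0 (rcons s c) k) <->
  (forall k, (k < size s)%N -> h k = nth t0 s k) /\ h (size s) = c.
Proof.
rewrite size_rcons; split => [hs|[hs hc] k].
  split=> [k ks|]; first by rewrite hs ?(leqW ks)// nth_rcons ks.
  by rewrite hs// nth_rcons ltnn eqxx.
rewrite ltnS leq_eqVlt => /orP[/eqP ->|ks].
  by rewrite nth_rcons ltnn eqxx.
by rewrite nth_rcons ks hs.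
Qed.

Lemma cvg_of_shrinking_balls (x : nat -> E) (q : nat -> E) :
  (forall n k, (k < n)%N -> ball (q k) k.+1%:R^-1 (x n)) -> cvg (x @ \oo).
Proof.
move=> xq; apply/cauchy_cvgP/cauchy_exP => e e0.
have [k] := ltr_add_invr e0; rewrite add0r => ke.
exists (q k); exists k.+1 => // n /= kn.
by apply: le_ball (ltW ke) _ _; exact: xq.
Qed.

(** The class of Souslin sets contains the given set, so its projection is the
    set of [w] that admit an infinite branch [h] and a point [x]; a second
    component of [h] forces [x] into balls of radius [1/(k+1)] around terms of a
    dense sequence. For a finite sequence [s], let [Z s] be the set of [w] for
    which some branch extending [s] works, and let [B s] be an envelope of it.
    As [Z s] is the union of the [Z (rcons s c)], the part of [B s] outside of
    all the [B (rcons s c)] is negligible. Off these countably many negligible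
    sets, each [w] in [B [::]] follows a branch through the envelopes. The sets
    [Z] along that branch are nonempty, and the points of [E] that witness this
    (possibly for other elements of [Omega]) form a Cauchy sequence whose limit
    is a valid point for [w]. Hence [B [::]] differs from the projection by a
    negligible set only. *)
Theorem measurable_projection (S : set (Omega * E)) :
  product_measurable H S -> H [set w | exists x, S (w, x)].
Proof.
move=> /(souslin_product_measurable _ sigmaH)[K [KH Kloc defS]].
have [q qP] := separable_dense_sequence sepE.
pose wit (h : nat -> nat * nat) w x :=
  (forall k, ball (q (h k).2) k.+1%:R^-1 x) /\
  forall j, ((K j (fun k => (h k).1)).1 `*` (K j (fun k => (h k).1)).2) (w, x).
pose agree (h : nat -> nat * nat) s :=
  forall k, (k < size s)%N -> h k = nth (0, 0)%N s k.
pose Z s := [set w | exists h x, agree h s /\ wit h w x].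
have ZE : [set w | exists x, S (w, x)] = Z [::].
  rewrite defS; apply/seteqP; split => [w [x [f fS]]|w [h [x [_ [_ hS]]]]].
    have /choice[b bP] k : exists i, ball (q i) k.+1%:R^-1 x.
      have [|i /ball_sym ?] := qP x k.+1%:R^-1; last by exists i.
      by rewrite invr_gt0.
    by exists (fun k => (f k, b k)), x.
  by exists x; exists (fun k => (h k).1).
have ZS s w : Z s w -> exists c, Z (rcons s c) w.
  move=> [h [x [hs hw]]]; exists (h (size s)), h, x; split => //.
  by apply/rcons_agree.
pose ext s : nat -> nat := fun k => (nth (0, 0)%N s k).1.
(* the case j = 0 forces the envelope of an empty tree set to be empty *)
pose C s j := if j is i.+1 then (K i (ext s)).1 else set0.
have HC s j : H (C s j).
  by case: j => [|j] /=; [exact: sigma_algebra_set0|have [] := KH j (ext s)].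
have /choice[B BP] s := measurable_envelope P _ sigmaH subH (Z s) _ (HC s).
pose N := \bigcup_s (B s `\` \bigcup_c B (rcons s c)).
have N0 : P.-negligible N.
  apply: negligible_bigcup_count => s.
  have [_ _ _] := BP s; apply.
    by apply: sigma_algebra_bigcup_count => // c; have [] := BP (rcons s c).
  move=> w /ZS[c Zc]; exists c => //.
  by have [_ + _ _] := BP (rcons s c); apply.
have BNZ : B [::] `\` N `<=` Z [::].
  move=> w [B0 nN].
  have [h hB] : exists h : nat -> nat * nat, forall n, B (mkseq h n) w.
    apply: (@exists_branch _ (0, 0)%N (fun s => B s w)) => // s Bs.
    apply: contrapT => nB; apply: nN; exists s => //; split => // -[c _ Bc].
    by apply: nB; exists c.
  pose f k := (h k).1.
  (* the rectangles of index j stabilise along the branch h *)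
  have stab j : exists n0, forall n h', (n0 <= n)%N -> agree h' (mkseq h n) ->
      K j (fun k => (h' k).1) = K j f.
    have [s sP] := Kloc j f; exists (\max_(i <- s) i).+1 => n h' sn h'h.
    apply: sP => i si; have ilt : (i < n)%N.
      by apply: leq_trans sn; rewrite ltnS; exact: leq_bigmax_seq.
    by rewrite /f h'h ?size_mkseq// nth_mkseq.
  have /choice[x xP] n : exists x, exists h' w',
      agree h' (mkseq h n) /\ wit h' w' x.
    have [_ _ BC _] := BP (mkseq h n).
    have [[w' [h' [x ?]]]|/nonemptyPn Z0] := pselect (Z (mkseq h n) !=set0).
      by exists x, h', w'.
    by have := BC 0%N; rewrite Z0 => /(_ (@sub0set _ _) _ (hB n)).
  have xcvg : cvg (x @ \oo).
    apply: (@cvg_of_shrinking_balls _ (fun k => q (h k).2)) => n k kn.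
    have [h' [w' [h'h [+ _]]]] := xP n => /(_ k).
    by rewrite h'h ?size_mkseq// nth_mkseq.
  rewrite -ZE defS; exists (lim (x @ \oo)); exists f => j; split => /=.
    have [n0 n0P] := stab j; have [_ _ /(_ j.+1) + _] := BP (mkseq h n0).
    rewrite /C (n0P n0 (fun k => nth (0, 0)%N (mkseq h n0) k))//.
    apply => // w' [h' [x' [h'h [_ /(_ j)]]]].
    by rewrite (n0P n0 h')// => -[].
  have Kx : \forall n \near \oo, (K j f).2 (x n).
    have [n0 n0P] := stab j; exists n0 => // n /= n0n.
    have [h' [w' [h'h [_ /(_ j)]]]] := xP n.
    by rewrite (n0P n h')// => -[].
  have [_ cK] := KH j f; exact: (closed_cvg _ cK Kx _ xcvg).
have [HB ZB _ _] := BP [::]; rewrite ZE.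
have -> : Z [::] = B [::] `\` (B [::] `\` Z [::]).
  rewrite setDD; apply/seteqP; split => [w Zw|w []//].
  by split => //; exact: ZB.
apply: sigma_algebra_setD => //; apply: nullH; apply: negligibleS N0.
by move=> w [Bw nZw]; apply: contrapT => nN; apply: nZw; exact: BNZ.
Qed.

End Projection.

(** * Random sets over a complete sigma-algebra *)

Section EffrosMeasurability.
Context {R : realType} {E : completeNormedModType R} (sepE : separable E).
Context {d : measure_display} {Omega : measurableType d}.
Variables (P : probability Omega R) (H : set (set Omega)).
Hypotheses (sigmaH : sigma_algebra setT H) (subH : H `<=` measurable).
Hypothesis nullH : P.-negligible `<=` H.
Implicit Types X Y : Omega -> set E.

(** Effros measurability would ask for all open sets; balls are enough over a
    separable space. Unlike measurability of the graph it is inherited by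
    pointwise sums, and it determines the closure. *)
Definition effros_measurable X : Prop :=
  forall x r, H [set w | X w `&` ball x r !=set0].

Lemma random_set_setI X Y : random_set H X -> random_set H Y ->
  random_set H (fun w => X w `&` Y w).
Proof. exact: (sigma_algebra_setI (product_measurable_sigma H)). Qed.

Lemma random_set_setC X : random_set H X -> random_set H (fun w => ~` X w).
Proof. exact: (sigma_algebra_setC (product_measurable_sigma H)). Qed.

Lemma random_set_bigcup {I : countType} (X : I -> Omega -> set E) :
  (forall i, random_set H (X i)) -> random_set H (fun w => \bigcup_i X i w).
Proof.
move=> rX.
exact: (sigma_algebra_bigcup_count (product_measurable_sigma H) _ rX).
Qed.

Lemma random_set_bigcap (X : nat -> Omega -> set E) :
  (forall i, random_set H (X i)) -> random_set H (fun w => \bigcap_i X i w).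
Proof.
move=> rX.
exact: (sigma_algebra_bigcapT (product_measurable_sigma H) _ rX).
Qed.

Lemma random_set_rect (A : set Omega) (O : set E) : H A -> open O ->
  random_set H (fun w => [set x | A w /\ O x]).
Proof. exact: product_measurable_rect. Qed.

Lemma random_set_nonempty X : random_set H X -> H [set w | X w !=set0].
Proof.
move=> rX; exact: (measurable_projection sepE P H sigmaH subH nullH _ rX).
Qed.

Lemma random_set_effros X : random_set H X -> effros_measurable X.
Proof.
move=> rX x r.
apply: random_set_nonempty; apply: random_set_setI => //.
have -> : (fun=> ball x r) = fun w : Omega => [set y | setT w /\ ball x r y].
  by apply/funext => w; apply/seteqP; split => [y|y []].
by apply: random_set_rect; [exact: sigma_algebra_setT|exact: ball_open].
Qed.

(** A ball of radius [r] around [phi y] meets [X w] iff, for some [n] and some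
    term [q] of a dense sequence at distance less than [1/(n+1)] from [phi y],
    the ball of radius [r - 1/(n+1)] around [q] meets [X w]. This makes the
    graph a countable union of measurable rectangles. *)
Lemma random_set_near X (phi : E -> E) (r : R) :
  effros_measurable X -> continuous phi ->
  random_set H (fun w => [set y | X w `&` ball (phi y) r !=set0]).
Proof.
move=> eX cphi; have [q qP] := separable_dense_sequence sepE.
have -> : (fun w => [set y | X w `&` ball (phi y) r !=set0]) =
    fun w => \bigcup_(k : nat) \bigcup_(n : nat)
      [set y | X w `&` ball (q k) (r - n.+1%:R^-1) !=set0 /\
         (phi @^-1` ball (q k) n.+1%:R^-1) y].
  apply/funext => w; apply/seteqP; split => y; last first.
    move=> [k _ [n _ [[u [Xu qu]] /= /ball_sym yq]]]; exists u; split => //.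
    by have := ball_triangle yq qu; rewrite addrC subrK.
  move=> [u [Xu]]; rewrite -ball_normE /= => yu.
  (* half of the slack, because 1/(n+1) is spent twice below *)
  have e0 : 0 < (r - `|phi y - u|) / 2 by rewrite divr_gt0// subr_gt0.
  have [n] := ltr_add_invr e0; rewrite add0r ltr_pdivlMr// => ne.
  have n0 : 0 < n.+1%:R^-1 :> R by rewrite invr_gt0.
  have [k] := qP (phi y) _ n0; rewrite -ball_normE /= distrC => yk.
  exists k => //; exists n => //; split => //; exists u; split => //=.
  rewrite -(subrKA (phi y)) (le_lt_trans (ler_normD _ _))// ltrBrDr.
  by rewrite addrAC -ltrBrDr (le_lt_trans _ ne)// mulr_natr mulr2n lerD2r ltW.
apply: random_set_bigcup => k; apply: random_set_bigcup => n.
apply: random_set_rect; first exact: eX.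
by move/continuousP: cphi; apply; exact: ball_open.
Qed.

Lemma closure_bigcapE (A : set E) :
  closure A = \bigcap_(n : nat) [set x | A `&` ball x n.+1%:R^-1 !=set0].
Proof.
apply/seteqP; split => [x clx n _|x Ax B /nbhs_ballP[e /= e0 eB]].
  by apply: clx; apply: nbhsx_ballx; rewrite invr_gt0.
have [n] := ltr_add_invr e0; rewrite add0r => ne.
have [y [Ay xy]] := Ax n I; exists y; split => //; apply: eB.
exact: le_ball (ltW ne) _ xy.
Qed.

Lemma random_set_closure X : effros_measurable X ->
  random_set H (fun w => closure (X w)).
Proof.
move=> eX.
have -> : (fun w => closure (X w)) = fun w =>
    \bigcap_(n : nat) [set x | X w `&` ball (id x) n.+1%:R^-1 !=set0].
  by apply/funext => w; rewrite closure_bigcapE.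
apply: random_set_bigcap => n; apply: random_set_near => // x; exact: cvg_id.
Qed.

(** The sum meets a ball around [x] iff some [y] in [Y w] is such that [X w]
    meets the ball of the same radius around [x - y]; the elimination of [y] is
    a projection. *)
Lemma effros_measurable_minkowski_sum X Y :
  random_set H X -> random_set H Y ->
  effros_measurable (fun w => minkowski_sum (X w) (Y w)).
Proof.
move=> rX rY x r.
have -> : [set w | minkowski_sum (X w) (Y w) `&` ball x r !=set0] =
    [set w | (Y w `&` [set y | X w `&` ball (x - y) r !=set0]) !=set0].
  apply/seteqP; split => w.
    move=> [_ [[u Xu [y Yy <-]]]]; rewrite -ball_normE /= => xr.
    exists y; split => //; exists u; split => //=.
    by rewrite /= -addrA -opprD (addrC y).
  move=> [y [/= Yy [u [Xu]]]]; rewrite -ball_normE /= => xr.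
  exists (u + y); split; first by exists u => //; exists y.
  by rewrite /= (addrC u) opprD addrA.
apply: random_set_nonempty.
apply: random_set_setI => //; apply: (random_set_near _ (fun y => x - y)).
  exact: random_set_effros.
by move=> y; apply: cvgB; [exact: cvg_cst|exact: cvg_id].
Qed.

(** A point [x] is outside of the difference iff some translate [x + y] has
    positive distance to [X w]. That property is stable under small changes of
    [x], so [x] may be replaced with a nearby term of a dense sequence, which
    leaves [y] as the only uncountable quantifier: a projection from
    [Omega * E] eliminates it.
    The radius [2/(n+1)] leaves room for moving the center by [1/(n+1)] while
    keeping a ball of radius [1/(n+1)] free of points of [X w]. *)
Lemma random_set_minkowski_difference X Y :
  random_set H X -> random_set H Y ->
  random_set H (fun w => [set x | forall y, Y w y -> closure (X w) (x + y)]).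
Proof.
move=> rX rY; have [q qP] := separable_dense_sequence sepE.
pose D k n := [set w | (Y w `&`
  ~` [set y | X w `&` ball (q k + y) (2 * n.+1%:R^-1) !=set0]) !=set0].
have HD k n : H (D k n).
  apply: random_set_nonempty.
  apply: random_set_setI => //; apply: random_set_setC.
  apply: (random_set_near _ (fun y => q k + y)); first exact: random_set_effros.
  by move=> y; apply: cvgD; [exact: cvg_cst|exact: cvg_id].
have -> : (fun w => [set x | forall y, Y w y -> closure (X w) (x + y)]) =
    fun w => ~` \bigcup_(k : nat) \bigcup_(n : nat)
      [set x | D k n w /\ ball (q k) n.+1%:R^-1 x].
  apply/funext => w; apply/seteqP; split => x.
    move=> xY [k _ [n _ [[y [Yy nX]] xk]]]; apply: nX.
    have n0 : 0 < n.+1%:R^-1 :> R by rewrite invr_gt0.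
    have [u [Xu xyu]] := xY _ Yy _ (nbhsx_ballx _ _ n0).
    exists u; split => //; move: xk xyu; rewrite -!ball_normE /= => xk xyu.
    have -> : q k + y - u = (q k - x) + (x + y - u) by rewrite addrA subrKA.
    by rewrite (le_lt_trans (ler_normD _ _))// mulr_natl mulr2n ltrD.
  move=> nD y Yy; rewrite closure_bigcapE => m _.
  (* a third: 2/(n+1) for the ball and 1/(n+1) for moving its center *)
  have m0 : 0 < m.+1%:R^-1 / 3 :> R by rewrite divr_gt0// invr_gt0.
  have [n] := ltr_add_invr m0; rewrite add0r ltr_pdivlMr// => nm.
  have n0 : 0 < n.+1%:R^-1 :> R by rewrite invr_gt0.
  have [k xk] := qP x _ n0.
  apply: contrapT => nX; apply: nD; exists k => //; exists n => //.
  split; last exact: ball_sym.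
  exists y; split => // -[u [Xu qu]]; apply: nX; exists u; split => //.
  move: xk qu; rewrite -!ball_normE /= => xk qu.
  have -> : x + y - u = (x - q k) + (q k + y - u) by rewrite addrA subrKA.
  rewrite (le_lt_trans (ler_normD _ _))// (lt_trans (ltrD xk qu))//.
  by rewrite (le_lt_trans _ nm)//; move: n.+1%:R^-1 => e; lra.
apply: random_set_setC; apply: random_set_bigcup => k.
apply: random_set_bigcup => n; apply: random_set_rect => //.
exact: ball_open.
Qed.

End EffrosMeasurability.

(** * Convexity and closedness of sums and differences *)

Section Convexity.
Context {R : realType} {E : completeNormedModType R}.
Implicit Types A B : set E.

Lemma convex_setE A : convex_set (A : set (convex_lmodType E)) <->
  forall x y (t : R), A x -> A y -> 0 <= t -> t <= 1 ->
    A (t *: x + (1 - t) *: y).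
Proof.
split => [cA x y t Ax Ay t0 t1|cA x y t].
  by have := cA x y (Itv01 t0 t1); rewrite !inE /= => /(_ Ax Ay).
rewrite !inE /= => Ax Ay; exact: cA.
Qed.

Lemma convex_set_minkowski_sum A B : convex_set (A : set (convex_lmodType E)) ->
  convex_set (B : set (convex_lmodType E)) ->
  convex_set (minkowski_sum A B : set (convex_lmodType E)).
Proof.
move=> /convex_setE cA /convex_setE cB; apply/convex_setE.
move=> _ _ t [x1 Ax1 [y1 By1 <-]] [x2 Ax2 [y2 By2 <-]] t0 t1.
exists (t *: x1 + (1 - t) *: x2); first exact: cA.
exists (t *: y1 + (1 - t) *: y2); first exact: cB.
by rewrite !scalerDr addrACA.
Qed.

Lemma convex_set_closure A : convex_set (A : set (convex_lmodType E)) ->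
  convex_set (closure A : set (convex_lmodType E)).
Proof.
move=> /convex_setE cA; apply/convex_setE => x y t clx cly t0 t1.
move=> V /nbhs_ballP[e /= e0 eV].
have [a [Aa xa]] := clx _ (nbhsx_ballx x _ e0).
have [b [Ab yb]] := cly _ (nbhsx_ballx y _ e0).
exists (t *: a + (1 - t) *: b); split; first exact: cA.
apply: eV; move: xa yb; rewrite -!ball_normE /= => xa yb.
rewrite opprD addrACA -!scalerBr (le_lt_trans (ler_normD _ _))// !normrZ.
rewrite ger0_norm// ger0_norm ?subr_ge0//.
have [->|tn0] := eqVneq t 0; first by rewrite mul0r add0r subr0 mul1r.
have -> : e = t * e + (1 - t) * e by rewrite -mulrDl subrKC mul1r.
rewrite ltr_leD//; first by rewrite ltr_pM2l// lt_neqAle eq_sym tn0.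
by rewrite ler_wpM2l ?subr_ge0// ltW.
Qed.

Lemma convex_set_minkowski_difference A B :
  convex_set (A : set (convex_lmodType E)) ->
  convex_set ([set x | forall y, B y -> A (x + y)] : set (convex_lmodType E)).
Proof.
move=> /convex_setE cA; apply/convex_setE => x1 x2 t AB1 AB2 t0 t1 y By.
have -> : t *: x1 + (1 - t) *: x2 + y = t *: (x1 + y) + (1 - t) *: (x2 + y).
  by rewrite !scalerDr addrACA -scalerDl subrKC scale1r.
by apply: cA => //; [exact: AB1|exact: AB2].
Qed.

Lemma closed_minkowski_difference A B : closed A ->
  closed [set x | forall y, B y -> A (x + y)].
Proof.
move=> cA.
have -> : [set x | forall y, B y -> A (x + y)] =
    \bigcap_(y in B) ((fun x => x + y) @^-1` A) by [].
apply: closed_bigI => y _.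
apply: closed_comp cA => x _.
by apply: cvgD; [exact: cvg_id|exact: cvg_cst].
Qed.

End Convexity.

(** * Completion of the conditioning sigma-algebra *)

Section Completion.
Context {R : realType} {E : completeNormedModType R}.
Context {d : measure_display} {Omega : measurableType d}.
Variables (P : probability Omega R) (H : set (set Omega)).
Hypothesis sigmaH : sigma_algebra setT H.

Definition completion : set (set Omega) :=
  [set D | exists2 B, H B & {ae P, forall w, D w <-> B w}].

Lemma sub_completion : H `<=` completion.
Proof. by move=> D HD; exists D => //; apply: filterE. Qed.

Lemma completion_sigma : sigma_algebra setT completion.
Proof.
split=> [|D [B HB DB]|D DP].
- by apply: sub_completion; exact: sigma_algebra_set0.
- exists (~` B); first exact: sigma_algebra_setC.
  by rewrite setTD; apply: filterS DB => w /= ->.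
- have /choice[B BP] i : exists B, H B /\ {ae P, forall w, D i w <-> B w}.
    by have [B HB DB] := DP i; exists B.
  exists (\bigcup_i B i).
    by apply: (sigma_algebra_bigcupT sigmaH) => i; case: (BP i).
  have : {ae P, forall w, forall i, D i w <-> B i w}.
    by apply: ae_foralln => i; case: (BP i).
  by apply: filterS => w DB; split => -[i _ /DB ?]; exists i.
Qed.

Lemma negligible_completion : P.-negligible `<=` completion.
Proof.
move=> N N0; exists set0; first exact: sigma_algebra_set0.
by apply: negligibleS N0 => w /= NN; apply: contrapT => nN; apply: NN.
Qed.

Lemma completion_measurable : measure_is_complete P -> H `<=` measurable ->
  completion `<=` measurable.
Proof.
move=> completeP subH D [B HB DB].
have mB : measurable B by exact: subH.
have mN (A : set Omega) : A `<=` ~` [set w | D w <-> B w] -> measurable A.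
  by move=> AN; apply: completeP; exact: negligibleS AN DB.
have -> : D = (B `\` (B `\` D)) `|` (D `\` B).
  rewrite setDD; apply/seteqP; split => [w Dw|w [[]|[]]//].
  by have [Bw|nBw] := pselect (B w); [left|right].
apply: measurableU; last by apply: mN => w [Dw nBw] [+ _] => /(_ Dw).
by apply: measurableD => //; apply: mN => w [Bw nDw] [_ /(_ Bw)].
Qed.

(** Sets of the product sigma-algebra over the completion whose sections agree,
    off a negligible set, with those of a set measurable over [H] form a
    sigma-algebra containing the generating cylinders. *)
Lemma random_set_completion (X : Omega -> set E) : random_set completion X ->
  exists2 X', random_set H X' & as_equal P X X'.
Proof.
pose C : set (set (Omega * E)) := [set S | exists2 S', product_measurable H S' &
  {ae P, forall w, forall x, S (w, x) <-> S' (w, x)}].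
have CH : product_measurable H `<=` C.
  by move=> S mS; exists S => //; apply: filterE.
have sigmaHE := product_measurable_sigma (E := E) H.
suff /[apply] : product_measurable completion `<=` C.
  move=> [S' mS' XS']; exists (fun w => [set x | S' (w, x)]).
    by congr (product_measurable H _) : mS'; apply/funext => -[].
  by apply: filterS XS' => w XS'; apply/seteqP; split => x /XS'.
apply: product_measurable_ind; first exact: completion_sigma.
- split=> [|S [S' mS' SS']|S SP].
  + by apply: CH; exact: (sigma_algebra_set0 sigmaHE).
  + exists (~` S'); first exact: (sigma_algebra_setC sigmaHE).
    by rewrite setTD; apply: filterS SS' => w /= SS' x; rewrite SS'.
  + have /choice[S' S'P] i : exists S', product_measurable H S' /\
        {ae P, forall w, forall x, S i (w, x) <-> S' (w, x)}.
      by have [S' mS' SS'] := SP i; exists S'.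
    exists (\bigcup_i S' i).
      by apply: (sigma_algebra_bigcupT sigmaHE) => i; case: (S'P i).
    have : {ae P, forall w, forall i x, S i (w, x) <-> S' i (w, x)}.
      by apply: ae_foralln => i; case: (S'P i).
    by apply: filterS => w SS' x; split => -[i _ /SS' ?]; exists i.
- move=> D [B HB DB]; exists (B `*` setT).
    by apply: product_measurable_rect => //; exact: openT.
  by apply: filterS DB => w DB x; split => -[/DB].
- move=> O oO; apply: CH; apply: product_measurable_rect => //.
  exact: sigma_algebra_setT.
Qed.

Lemma random_set_sub_completion (X : Omega -> set E) :
  random_set H X -> random_set completion X.
Proof.
suff : @product_measurable R E d Omega H `<=` product_measurable completion.
  by move=> HC; exact: HC.
have sH := sigma_algebra_setT sigmaH.
apply: product_measurable_ind => //; first exact: product_measurable_sigma.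
- move=> A HA; apply: product_measurable_rect; last exact: openT.
  exact: sub_completion.
- by move=> O oO; apply: product_measurable_rect => //; exact: sub_completion.
Qed.

(** The hull does not change when [H] is completed: every competitor measurable
    over the completion is a.s. equal to one measurable over [H]. *)
Lemma cond_convex_hull_completion (X M : Omega -> set E) :
  is_cond_convex_hull P H X M -> is_cond_convex_hull P completion X M.
Proof.
move=> [[rM cM clM] XM minM]; split => //.
  by split => //; exact: random_set_sub_completion.
move=> N [/random_set_completion[N' rN' NN'] cN clN] XN.
have MN' : as_subset P M N'.
  apply: minM.
    split => //.
      by move: NN' cN; apply: filterS2 => w ->.
    by move: NN' clN; apply: filterS2 => w ->.
  by move: NN' XN; apply: filterS2 => w ->.
by move: NN' MN'; apply: filterS2 => w ->.
Qed.

End Completion.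

(** * Conditional convex hulls of sums *)

Section ConditionalHull.
Context {R : realType} {E : completeNormedModType R} (sepE : separable E).
Context {d : measure_display} {Omega : measurableType d}.
Variables (P : probability Omega R) (H : set (set Omega)).
Hypotheses (sigmaH : sigma_algebra setT H) (subH : H `<=` measurable).
Hypothesis nullH : P.-negligible `<=` H.
Implicit Types X Y M N : Omega -> set E.

Lemma random_convex_closed_minkowski_sum X Y :
  random_set H X -> as_convex P X -> random_set H Y -> as_convex P Y ->
  random_convex_closed_set P H
    (fun w => closure (minkowski_sum (X w) (Y w))).
Proof.
move=> rX cX rY cY; split; last by apply: filterE => w; exact: closed_closure.
  apply: random_set_closure => //.
  exact: (effros_measurable_minkowski_sum sepE P H sigmaH subH nullH).
move: cX cY; apply: filterS2 => w cX cY.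
exact/convex_set_closure/convex_set_minkowski_sum.
Qed.

Lemma random_convex_closed_minkowski_difference M Y :
  random_convex_closed_set P H M -> random_set H Y ->
  random_convex_closed_set P H
    (fun w => [set x | forall y, Y w y -> closure (M w) (x + y)]).
Proof.
move=> [rM cM clM] rY; split.
- exact: (random_set_minkowski_difference sepE P H sigmaH subH nullH).
- apply: filterS cM => w cM.
  exact/convex_set_minkowski_difference/convex_set_closure.
- apply: filterE => w; apply: closed_minkowski_difference.
  exact: closed_closure.
Qed.

(** The closure of the sum of [X'] and [Y'] competes in the definition of the
    hull of [X + Y]. *)
Lemma cond_convex_hull_sum_subset X Y X' Y' M :
  is_cond_convex_hull P H (fun w => minkowski_sum (X w) (Y w)) M ->
  random_set H X' -> as_convex P X' -> as_subset P X X' ->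
  random_set H Y' -> as_convex P Y' -> as_subset P Y Y' ->
  as_subset P M (fun w => closure (minkowski_sum (X' w) (Y' w))).
Proof.
move=> [_ _ minM] rX' cX' XX' rY' cY' YY'; apply: minM.
  exact: random_convex_closed_minkowski_sum.
move: XX' YY'; apply: filterS2 => w XX' YY' z [x Xx [y Yy <-]].
by apply: subset_closure; exists x; [exact: XX'|exists y => //; exact: YY'].
Qed.

(** The points [x] such that [x + Y] stays in [M] form a competitor for the
    hull of [X]. *)
Lemma cond_convex_hull_sum_supset X Y MX M :
  is_cond_convex_hull P H X MX -> random_set H Y ->
  is_cond_convex_hull P H (fun w => minkowski_sum (X w) (Y w)) M ->
  as_subset P (fun w => closure (minkowski_sum (MX w) (Y w))) M.
Proof.
move=> [_ _ minMX] rY [rM XYM _].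
have MXD : as_subset P MX
    (fun w => [set x | forall y, Y w y -> closure (M w) (x + y)]).
  apply: minMX; first exact: random_convex_closed_minkowski_difference.
  apply: filterS XYM => w XYM x Xx y Yy.
  by apply: subset_closure; apply: XYM; exists x => //; exists y.
have [_ _ clM] := rM; move: clM MXD; apply: filterS2 => w clM MXD.
(* M w is a.s. closed, so it coincides with the closure in MXD *)
have {}clM := (closure_id (M w)).1 clM; rewrite [X in _ `<=` X]clM.
apply: closureS => _ [x /MXD MXx [y Yy <-]].
by rewrite clM; exact: MXx.
Qed.

End ConditionalHull.

Theorem proposition5p4
    (R : realType) (E : completeNormedModType R) (sepE : separable E)
    (d : measure_display) (Omega : measurableType d)
    (P : probability Omega R) (completeP : measure_is_complete P)
    (H : set (set Omega)) (sigmaH : sigma_algebra setT H)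
    (subH : H `<=` measurable)
    (X Y : Omega -> set E)
    (rX : random_set measurable X) (rY : random_set measurable Y)
    (MX MXY : Omega -> set E)
    (hMX : is_cond_convex_hull P H X MX)
    (hMXY : is_cond_convex_hull P H (fun w => minkowski_sum (X w) (Y w)) MXY) :
  (forall MY : Omega -> set E, is_cond_convex_hull P H Y MY ->
     as_subset P MXY (fun w => closure (minkowski_sum (MX w) (MY w)))) /\
  (random_set H Y -> as_convex P Y ->
     as_equal P MXY (fun w => closure (minkowski_sum (MX w) (Y w)))).
Proof.
(* From here on H is replaced by its completion for P. *)
have sigmaHP := completion_sigma P H sigmaH.
have subHP := completion_measurable P H completeP subH.
have nullHP := negligible_completion P H sigmaH.
have {}hMX := cond_convex_hull_completion P H sigmaH _ _ hMX.
have {}hMXY := cond_convex_hull_completion P H sigmaH _ _ hMXY.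
have [[rMX cMX _] XMX _] := hMX.
split=> [MY /(cond_convex_hull_completion P H sigmaH)|rHY cY].
  move=> [[rMY cMY _] YMY _].
  exact: (cond_convex_hull_sum_subset sepE P _ sigmaHP subHP nullHP X Y).
have {}rHY := random_set_sub_completion P H sigmaH _ rHY.
have sub : as_subset P MXY (fun w => closure (minkowski_sum (MX w) (Y w))).
  apply: (cond_convex_hull_sum_subset sepE P _ sigmaHP subHP nullHP X Y) => //.
  by apply: filterE => w; exact: subset_refl.
have sup := cond_convex_hull_sum_supset sepE P _ sigmaHP subHP nullHP
  _ _ _ _ hMX rHY hMXY.
by move: sub sup; apply: filterS2 => w; rewrite eqEsubset.
Qed.
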